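(* Let $L$ be an $n$-dimensional almost Abelian but not Abelian Lie algebra over a field of characteristic $0$, with a fixed basis $\{e_1,\dots,e_n\}$ such that $\langle e_1,\dots,e_{n-1}\rangle$ is an Abelian ideal of $L$ and $\langle e_1,\dots,e_m\rangle=Z$, where $Z$ is the center of $L$ and $m=\dim Z<n-1$. In the chosen basis the nonzero commutation relations take the form $[e_n,e_j]=\sum_{i=1}^{n-1}a_{ij}e_i$, $j=1,\dots,n-1$, and thus define the matrix $A=(a_{ij})$ of size $(n-1)\times(n-1)$, where the first $m$ columns of $A$ are zero and the rank of $A$ equals $n-1-m$. A linear operator $J$ on $L$ is Lie-orthogonal if and only if its matrix in the basis $\{e_1,\dots,e_n\}$ has one of the following forms depending on $\dim Z$: 1. If $m=\dim Z<n-2$: \[ \left(\begin{array}{ccc} B_0&B_1&B_2\\ 0&\mu E&B_3\\ 0&0&\mu^{-1} \end{array}\right), \] where $B_0$, $B_1$, $B_2$ and $B_3$ are arbitrary $m\times m$, $m\times(n-m-1)$, $m\times 1$ and $(n-m-1)\times 1$ matrices, respectively, $\mu$ is an arbitrary nonzero constant, $E$ is the unit matrix of size $n-m-1$, and zeros denote zero matrices of appropriate sizes. 2. If $m=\dim Z=n-2$, i.e., the algebra $L$ is isomorphic either to $(n-2)\mathfrak g_1\oplus\mathfrak g_2$ or to the direct sum of $(n-3)\mathfrak g_1$ and the three-dimensional Heisenberg algebra: \[ \left(\begin{array}{cc} B_0&B_1\\ 0&C \end{array}\right), \] where $B_0$ and $B_1$ are arbitrary $(n-2)\times(n-2)$ and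 $(n-2)\times 2$ matrices, respectively, $0$ is the zero $2\times(n-2)$ matrix, and $C$ is an arbitrary $2\times 2$ matrix with determinant equal to one, i.e., $C\in\mathrm{SL}_2$.
   Context: A linear operator $J$ on a Lie algebra $L$ is called Lie-orthogonal if $[Jx,Jy]=[x,y]$ for all $x,y\in L$. A Lie algebra is called almost Abelian if it contains an Abelian ideal of codimension $1$. $\mathfrak g_1$ is the one-dimensional Lie algebra, $\mathfrak g_2$ is the two-dimensional non-Abelian Lie algebra, $k\mathfrak g_1$ is the direct sum of $k$ copies of $\mathfrak g_1$, and the three-dimensional Heisenberg algebra has a basis $\{e,p,q\}$ with the only nonzero commutation relation $[p,q]=e$. The columns of the matrix of an operator are the coordinates of the images of the basis elements. *)

(* Defs.v *)
From HB Require Import structures.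
From mathcomp Require Import all_boot all_algebra.
From mathcomp Require Import ring.

Set Implicit Arguments.
Unset Strict Implicit.
Unset Printing Implicit Defensive.

Import GRing.Theory.
Local Open Scope ring_scope.

HB.mixin Record Vector_isLieAlgebra (F : fieldType) L of Vector F L := {
  lie : L -> L -> L;
  lie_linear_l : forall y, linear (fun x => lie x y);
  lie_linear_r : forall x, linear (lie x);
  liexx : forall x, lie x x = 0;
  lie_jacobi : forall x y z,
    lie x (lie y z) + lie y (lie z x) + lie z (lie x y) = 0
}.

#[short(type="lieAlgType")]
HB.structure Definition LieAlgebra (F : fieldType) :=
  { L of Vector F L & Vector_isLieAlgebra F L }.

Section LieNotions.
Variables (F : fieldType) (L : lieAlgType F).

Definition abelian_lie : Prop := forall x y : L, lie x y = 0.

Definition abelian_subspace (U : {vspace L}) : Prop :=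
  forall x y, x \in U -> y \in U -> lie x y = 0.

Definition lie_ideal (U : {vspace L}) : Prop :=
  forall x y, y \in U -> lie x y \in U.

Definition is_center (Z : {vspace L}) : Prop :=
  forall x, x \in Z <-> (forall y, lie x y = 0).

Definition almost_abelian : Prop :=
  exists U : {vspace L},
    [/\ lie_ideal U, abelian_subspace U & (\dim U).+1 = \dim {:L}].

Definition lie_orthogonal (J : 'End(L)) : Prop :=
  forall x y, lie (J x) (J y) = lie x y.

(* Column convention: column j holds the coordinates of J e_j, so this is the
   transpose of [mxof e e J]. *)
Definition operator_mx n (e : n.-tuple L) (J : 'End(L)) : 'M[F]_n :=
  \matrix_(i < n, j < n) coord e i (J e`_j).

(* The basis is numbered from 0: the last vector is e`_(n.-1), and
   column j of this matrix holds the first n - 1 coordinates of [e_n, e_j]. *)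
Definition structure_mx n (e : n.-tuple L) : 'M[F]_n.-1 :=
  \matrix_(i < n.-1, j < n.-1)
    coord e (widen_ord (leq_pred n) i) (lie e`_n.-1 e`_j).

End LieNotions.

Definition lie_isomorphic (F : fieldType) (L1 L2 : lieAlgType F) : Prop :=
  exists f : 'Hom(L1, L2),
    bijective f /\ (forall x y, f (lie x y) = lie (f x) (f y)).

Section DirectSum.
Variables (F : fieldType) (L1 L2 : lieAlgType F).

Definition lie_pair (x y : L1 * L2) : L1 * L2 := (lie x.1 y.1, lie x.2 y.2).

Fact lie_pair_linear_l y : linear (fun x => lie_pair x y).
Proof. by move=> a u v; congr pair; rewrite /= lie_linear_l. Qed.

Fact lie_pair_linear_r x : linear (lie_pair x).
Proof. by move=> a u v; congr pair; rewrite /= lie_linear_r. Qed.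

Fact lie_pairxx x : lie_pair x x = 0.
Proof. by rewrite /lie_pair !liexx. Qed.

Fact lie_pair_jacobi x y z :
  lie_pair x (lie_pair y z) + lie_pair y (lie_pair z x)
    + lie_pair z (lie_pair x y) = 0.
Proof. by congr pair; rewrite /= lie_jacobi. Qed.

HB.instance Definition _ := Vector_isLieAlgebra.Build F (L1 * L2)%type
  lie_pair_linear_l lie_pair_linear_r lie_pairxx lie_pair_jacobi.

End DirectSum.

Section Copies.
Variables (F : fieldType) (k : nat) (L : lieAlgType F).

Implicit Types x y z : {ffun 'I_k -> L}.

Definition lie_ffun x y : {ffun 'I_k -> L} := [ffun i => lie (x i) (y i)].

Fact lie_ffun_linear_l y : linear (fun x => lie_ffun x y).
Proof. by move=> a u v; apply/ffunP=> i; rewrite !ffunE lie_linear_l. Qed.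

Fact lie_ffun_linear_r x : linear (lie_ffun x).
Proof. by move=> a u v; apply/ffunP=> i; rewrite !ffunE lie_linear_r. Qed.

Fact lie_ffunxx x : lie_ffun x x = 0.
Proof. by apply/ffunP=> i; rewrite !ffunE liexx. Qed.

Fact lie_ffun_jacobi x y z :
  lie_ffun x (lie_ffun y z) + lie_ffun y (lie_ffun z x)
    + lie_ffun z (lie_ffun x y) = 0.
Proof. by apply/ffunP=> i; rewrite !ffunE lie_jacobi. Qed.

HB.instance Definition _ := Vector_isLieAlgebra.Build F {ffun 'I_k -> L}
  lie_ffun_linear_l lie_ffun_linear_r lie_ffunxx lie_ffun_jacobi.

End Copies.

Section SmallAlgebras.
Variable F : fieldType.

Definition g1 := F^o.

HB.instance Definition _ := Vector.on g1.

Definition g1_lie (x y : g1) : g1 := 0.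

Fact g1_lie_linear_l y : linear (fun x => g1_lie x y).
Proof. by move=> a u v; rewrite /g1_lie scaler0 addr0. Qed.

Fact g1_lie_linear_r x : linear (g1_lie x).
Proof. by move=> a u v; rewrite /g1_lie scaler0 addr0. Qed.

Fact g1_liexx x : g1_lie x x = 0. Proof. by []. Qed.

Fact g1_lie_jacobi x y z :
  g1_lie x (g1_lie y z) + g1_lie y (g1_lie z x) + g1_lie z (g1_lie x y) = 0.
Proof. by rewrite /g1_lie !addr0. Qed.

HB.instance Definition _ := Vector_isLieAlgebra.Build F g1
  g1_lie_linear_l g1_lie_linear_r g1_liexx g1_lie_jacobi.

(* The bracket on F^n whose only nonzero relation, up to antisymmetry, is
   [u_p, u_q] = u_e, where (u_i) is the standard basis. *)
Definition one_relation n (e p q : 'I_n) (x y : 'rV[F]_n) : 'rV[F]_n :=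
  (x 0 p * y 0 q - x 0 q * y 0 p) *: delta_mx 0 e.

Fact one_relation_linear_l n (e p q : 'I_n) y :
  linear (fun x => one_relation e p q x y).
Proof.
move=> a u v; rewrite /one_relation scalerA -scalerDl; congr (_ *: _).
by rewrite !mxE; ring.
Qed.

Fact one_relation_linear_r n (e p q : 'I_n) x : linear (one_relation e p q x).
Proof.
move=> a u v; rewrite /one_relation scalerA -scalerDl; congr (_ *: _).
by rewrite !mxE; ring.
Qed.

Fact one_relationxx n (e p q : 'I_n) x : one_relation e p q x x = 0.
Proof. by rewrite /one_relation mulrC subrr scale0r. Qed.

(* g_2 has basis u_0, u_1 with [u_0, u_1] = u_0. *)
Definition g2 := 'rV[F]_2.

HB.instance Definition _ := Vector.on g2.

Definition g2_lie : g2 -> g2 -> g2 :=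
  one_relation (0 : 'I_2) (0 : 'I_2) (1 : 'I_2).

Fact g2_lie_jacobi x y z :
  g2_lie x (g2_lie y z) + g2_lie y (g2_lie z x) + g2_lie z (g2_lie x y) = 0.
Proof.
rewrite /g2_lie /one_relation -!scalerDl !mxE /=.
by rewrite [X in X *: _](_ : _ = 0) ?scale0r //; ring.
Qed.

HB.instance Definition _ := Vector_isLieAlgebra.Build F g2
  (one_relation_linear_l _ _ _) (one_relation_linear_r _ _ _)
  (one_relationxx _ _ _) g2_lie_jacobi.

(* The basis {e, p, q} is u_0, u_1, u_2. *)
Definition heisenberg := 'rV[F]_3.

HB.instance Definition _ := Vector.on heisenberg.

Definition heisenberg_lie : heisenberg -> heisenberg -> heisenberg :=
  one_relation (0 : 'I_3) (1 : 'I_3) (2 : 'I_3).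

Fact heisenberg_lie_jacobi x y z :
  heisenberg_lie x (heisenberg_lie y z) + heisenberg_lie y (heisenberg_lie z x)
    + heisenberg_lie z (heisenberg_lie x y) = 0.
Proof.
rewrite /heisenberg_lie /one_relation -!scalerDl !mxE /=.
by rewrite !mulr0 !subrr !addr0 scale0r.
Qed.

HB.instance Definition _ := Vector_isLieAlgebra.Build F heisenberg
  (one_relation_linear_l _ _ _) (one_relation_linear_r _ _ _)
  (one_relationxx _ _ _) heisenberg_lie_jacobi.

End SmallAlgebras.

Section MatrixForms.
Variables (F : fieldType) (n m : nat) (M : 'M[F]_n).

(* The size equation is existentially quantified only to make the block matrix
   well typed; being an equation in nat it has at most one proof. *)
Definition three_block_form : Prop :=
  exists (E : (m + ((n - m - 1) + 1))%N = n)
    (B0 : 'M[F]_m) (B1 : 'M[F]_(m, n - m - 1)) (B2 : 'M[F]_(m, 1))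
    (B3 : 'M[F]_(n - m - 1, 1)) (mu : F),
    mu != 0 /\
    M = castmx (E, E)
          (block_mx B0 (row_mx B1 B2)
                    0  (block_mx mu%:M B3
                                 0     (mu^-1)%:M)).

Definition two_block_form : Prop :=
  exists (E : ((n - 2) + 2)%N = n)
    (B0 : 'M[F]_(n - 2)) (B1 : 'M[F]_(n - 2, 2)) (C : 'M[F]_2),
    \det C = 1 /\ M = castmx (E, E) (block_mx B0 B1 0 C).

End MatrixForms.

(* Main.v *)
Require Import Defs.
From HB Require Import structures.
From mathcomp Require Import all_boot all_algebra.
From mathcomp Require Import ring zify.

Set Implicit Arguments.
Unset Strict Implicit.
Unset Printing Implicit Defensive.

Import GRing.Theory.
Local Open Scope ring_scope.

(* Write t for the last basis vector, a for the last coordinate and D = [t, .].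
   Then [x, y] = a(x) D y - a(y) D x, and the center is the common kernel of a and D.
   If D has rank at least 2, orthogonality of J forces a o J to vanish on ker a;
   hence a o J = mu^-1 a, and D J = mu D on ker a.  If D has rank 1, then
   [x, y] = (a(x) b(y) - a(y) b(x)) w for the last two coordinates b, a and a fixed
   w <> 0, so J is orthogonal iff it preserves the center and has determinant 1 modulo
   it; L is then (n-2)g1 + g2 if b(w) <> 0, and (n-3)g1 + Heisenberg otherwise. *)

(** * Bilinearity and antisymmetry of the bracket *)

HB.instance Definition _ (F : fieldType) (L : lieAlgType F) (x : L) :=
  GRing.isLinear.Build F L L *:%R (lie x) (lie_linear_r x).

Section LieBasics.
Variables (F : fieldType) (L : lieAlgType F).
Implicit Types x y z : L.

Lemma lieDl x y z : lie (x + y) z = lie x z + lie y z.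
Proof. by have := lie_linear_l z 1 x y; rewrite !scale1r. Qed.

Lemma lieC x y : lie x y = - lie y x.
Proof.
apply/eqP; rewrite -addr_eq0; have := liexx (x + y).
by rewrite lieDl !linearD /= !liexx add0r addr0 => /eqP.
Qed.

Lemma lieZl a x y : lie (a *: x) y = a *: lie x y.
Proof. by rewrite lieC linearZ /= -scalerN -lieC. Qed.

Lemma lieBl x y z : lie (x - y) z = lie x z - lie y z.
Proof. by rewrite lieDl -scaleN1r lieZl scaleN1r. Qed.

Lemma lieZr a x y : lie x (a *: y) = a *: lie x y.
Proof. by rewrite linearZ. Qed.

Lemma lieBr x y z : lie x (y - z) = lie x y - lie x z.
Proof. by rewrite linearB. Qed.

End LieBasics.

(** * Bijectivity by dimension, and spans of initial segments of a basis *)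

Lemma lker0_bijective (F : fieldType) (U V : vectType F) (f : 'Hom(U, V)) :
  lker f == 0%VS -> \dim {:U} = \dim {:V} -> bijective f.
Proof.
move=> f_inj dimUV; exists (f^-1)%VF; first exact: lker0_lfunK.
move=> v; apply: limg_lfunVK; suff -> : limg f = fullv by rewrite memvf.
by apply/eqP; rewrite eqEdim subvf limg_dim_eq ?dimUV //= (eqP f_inj) capv0.
Qed.

(** Turns the spans given for the ideal and for the center into equations on coordinates. *)
Lemma memv_span_take (F : fieldType) (V : vectType F) n (e : n.-tuple V) k v :
  basis_of {:V} e ->
  reflect (forall i : 'I_n, (k <= i)%N -> coord e i v = 0)
          (v \in <<take k e>>%VS).
Proof.
move=> e_basis; have e_free := basis_free e_basis; apply: (iffP idP) => [v_in i le_ki|c0].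
  rewrite (@coord_span _ _ _ (in_tuple (take k e)) _ v_in) linear_sum big1 // => j _.
  have := ltn_ord j; rewrite {2}size_take_min size_tuple leq_min => /andP[lt_jk lt_jn].
  rewrite linearZ /= nth_take // (coord_free (Ordinal lt_jn)) // -val_eqE /=.
  by rewrite ltn_eqF ?mulr0 //; apply: leq_trans le_ki.
rewrite (coord_basis e_basis (memvf v)); apply: memv_suml => i _.
have [/c0->|lt_ik] := leqP k i; first by rewrite scale0r mem0v.
apply/memvZ/memv_span; rewrite -(nth_take _ lt_ik) mem_nth //.
by rewrite size_take_min size_tuple leq_min lt_ik ltn_ord.
Qed.

(** * Orthogonal operators when D has rank at least 2 on the kernel of [a] *)

Section Orthogonal.
Variables (F : fieldType) (L : lieAlgType F) (a : {scalar L}) (t : L).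
Hypothesis at1 : a t = 1.
Hypothesis lieE : forall x y : L, lie x y = a x *: lie t y - a y *: lie t x.
Variable J : 'End(L).

(* If [a] does not vanish on [J x0] for some [x0] with [a x0 = 0], orthogonality
   forces the image of [lie t] to be the line spanned by [lie t x0]. *)
Lemma lie_orthogonalP :
  ~ (exists v, forall u, a u = 0 -> lie t u \in <[v]>%VS) ->
  lie_orthogonal J <->
  exists mu, [/\ mu != 0, forall x, a (J x) = mu^-1 * a x
    & forall u, a u = 0 -> lie t (J u) = mu *: lie t u].
Proof.
move=> rank2; split=> [Jorth|[mu [mu0 aJ DJ]] x y]; last first.
  (* The vector [x0 - a x0 *: t] lies in the kernel of [a], where the hypothesis on [J] applies. In
     the bracket of [J x] and [J y], the two resulting multiples of [lie t (J t)] cancel. *)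
  have DJ' x0 : lie t (J x0) = mu *: lie t x0 + a x0 *: (lie t (J t)).
    have au0 : a (x0 - a x0 *: t) = 0 by rewrite linearB linearZ /= at1 mulr1 subrr.
    have EJ : J (x0 - a x0 *: t) = J x0 - a x0 *: J t by rewrite linearB linearZ.
    have := DJ _ au0; rewrite EJ !lieBr !lieZr liexx.
    by rewrite scaler0 subr0 => /eqP; rewrite subr_eq => /eqP.
  rewrite lieE [RHS]lieE !aJ (DJ' x) (DJ' y) !scalerDr !scalerA opprD addrACA.
  rewrite -[X in _ + X = _]scalerBl [X in _ + X *: _](_ : _ = 0); last by ring.
  rewrite scale0r addr0.
  by congr (_ *: _ - _ *: _); field.
have key u v : a (J u) *: lie t (J v) - a (J v) *: lie t (J u)
             = a u *: lie t v - a v *: lie t u.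
  by rewrite -!lieE Jorth.
have aJ0 x : a x = 0 -> a (J x) = 0.
  move=> ax0; apply/eqP; case: eqP => // /eqP aJx0; case: rank2; exists (lie t x).
  move=> u au0; rewrite memvE -[lie t u]scale1r -(mulfV aJx0) mulrC -scalerA.
  apply/memvZ.
  (* Multiplying [e2] by [a (J x)] and [e3] by [a (J u)] and subtracting eliminates [lie t (J t)];
     what remains besides the claim is [a (J t)] times [e1], hence zero. *)
  have e1 := key u x; have e2 := key u t; have e3 := key x t.
  rewrite ax0 au0 !scale0r subr0 in e1.
  rewrite au0 at1 scale0r scale1r sub0r in e2.
  rewrite ax0 at1 scale0r scale1r sub0r in e3.
  have -> : a (J x) *: lie t u = a (J u) *: lie t x; last exact: memvZ (memv_line _).
  move: e1 e2 e3; set p := lie t (J x); set q := lie t (J u); set r := lie t (J t).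
  move=> e1 /eqP; rewrite -eqr_oppLR => /eqP <- /eqP; rewrite -eqr_oppLR => /eqP <-.
  rewrite !scalerN !scalerBr !scalerA; congr (- _).
  rewrite [_ * a (J u)]mulrC; congr (_ - _).
  rewrite ![_ * a (J t)]mulrC -!scalerA; congr (_ *: _).
  by apply/eqP; rewrite eq_sym -subr_eq0 e1.
set nu := a (J t).
(* By [aJ0], a o J is a multiple of [a]; evaluation at [t] gives the factor. *)
have aJ x : a (J x) = nu * a x.
  apply/eqP; rewrite -subr_eq0; apply/eqP.
  have := aJ0 (x - a x *: t); rewrite !linearB /= !linearZ /= at1 mulr1 subrr.
  by move=> /(_ erefl); rewrite -/nu mulrC.
have DJ u : a u = 0 -> nu *: lie t (J u) = lie t u.
  move=> au0; have := key t u; rewrite (aJ0 u au0) -/nu au0 at1 !scale0r !subr0.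
  by rewrite scale1r.
(* If [nu] were zero, [DJ] would make D vanish on the kernel of [a], so that [v = 0] would
   contradict [rank2]. *)
have nu0 : nu != 0.
  apply/eqP=> nu0; case: rank2; exists 0 => u /DJ <-.
  by rewrite nu0 scale0r mem0v.
exists nu^-1; split; rewrite ?invr_eq0 ?invrK // => u /DJ <-.
by rewrite scalerA mulVf // scale1r.
Qed.

End Orthogonal.

(** * Orthogonal operators when the derived algebra is a line *)

Section OrthogonalRank1.
Variables (F : fieldType) (L : lieAlgType F) (a b : {scalar L}) (w t s : L).
Hypothesis w0 : w != 0.
Hypothesis lieE : forall x y : L, lie x y = (a x * b y - a y * b x) *: w.
Hypotheses (at1 : a t = 1) (as0 : a s = 0) (bt0 : b t = 0) (bs1 : b s = 1).
Variable J : 'End(L).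

(** Since [w] is nonzero, orthogonality means that [J] preserves the alternating form a(x) b(y) -
    a(y) b(x). Its radical is the common kernel of [a] and [b], and on the quotient, with basis [t],
    [s], the form is multiplied by the determinant of the induced map. *)
Lemma lie_orthogonal_rank1P :
  lie_orthogonal J <->
  (forall x, a x = 0 -> b x = 0 -> a (J x) = 0 /\ b (J x) = 0) /\
  a (J t) * b (J s) - a (J s) * b (J t) = 1.
Proof.
split=> [Jorth|[J0 Jdet] x y].
  have key x y : a (J x) * b (J y) - a (J y) * b (J x) = a x * b y - a y * b x.
    have /eqP := Jorth x y; rewrite !lieE -subr_eq0 -scalerBl scaler_eq0.
    by rewrite (negPf w0) orbF subr_eq0 => /eqP.
  have Jdet : a (J t) * b (J s) - a (J s) * b (J t) = 1.
    by rewrite key at1 as0 bt0 bs1 mulr1 mul0r subr0.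
  split=> // x ax0 bx0; have := key x t; have := key x s.
  rewrite ax0 bx0 !mul0r !mulr0 !subr0 => ks kt.
  split.
    (* Cramer's rule: multiplied by the determinant, which is 1, [a (J x)] becomes a combination of
       the pairings of [J x] with [J t] and [J s]. Both vanish by [kt] and [ks]. *)
    have -> : a (J x) = a (J x) * (a (J t) * b (J s) - a (J s) * b (J t)).
      by rewrite Jdet mulr1.
    rewrite (_ : _ * _ = a (J t) * (a (J x) * b (J s) - a (J s) * b (J x))
      - a (J s) * (a (J x) * b (J t) - a (J t) * b (J x))); last by ring.
    by rewrite ks kt; ring.
  have -> : b (J x) = b (J x) * (a (J t) * b (J s) - a (J s) * b (J t)).
    by rewrite Jdet mulr1.
  rewrite (_ : _ * _ = b (J t) * (a (J x) * b (J s) - a (J s) * b (J x))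
    - b (J s) * (a (J x) * b (J t) - a (J t) * b (J x))); last by ring.
  by rewrite ks kt; ring.
(* Removing from [z] its components along [t] and [s] leaves a vector of the radical, to which [J0]
   applies. *)
have J2 z : a (J z) = a z * a (J t) + b z * a (J s) /\
            b (J z) = a z * b (J t) + b z * b (J s).
  have := J0 (z - a z *: t - b z *: s).
  rewrite !linearB /= !linearZ /= at1 as0 bt0 bs1 !mulr1 !mulr0 subrr !subr0 subrr.
  move=> /(_ erefl erefl) [/eqP ea /eqP eb].
  move: ea eb; rewrite !subr_eq !add0r => /eqP-> /eqP->.
  by rewrite ![b z * _ + _]addrC.
rewrite !lieE; congr (_ *: _); have [-> ->] := J2 x; have [-> ->] := J2 y.
by rewrite -[RHS]mulr1 -Jdet; ring.
Qed.

End OrthogonalRank1.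

(** * The block forms as conditions on matrix entries *)

Section MatrixForms.
Variable F : fieldType.

Let block_mxE := (block_mxEul, block_mxEur, block_mxEdl, block_mxEdr,
                  row_mxEl, row_mxEr).

(** The total size is a variable so that destructing [E] turns the cast into the identity. As [B0],
    [B1], [B2] and [B3] are free, only the last row and the first m + l columns of the middle rows
    are constrained. *)
Lemma castmx_three_block m l n (E : (m + (l + 1))%N = n) (M : 'M[F]_n) mu :
  (exists (B0 : 'M[F]_m) (B1 : 'M[F]_(m, l)) (B2 : 'M[F]_(m, 1))
     (B3 : 'M[F]_(l, 1)),
     M = castmx (E, E) (block_mx B0 (row_mx B1 B2)
                          0 (block_mx mu%:M B3 0 (mu^-1)%:M))) <->
  (forall i j : 'I_n, i = (m + l)%N :> nat -> M i j = mu^-1 *+ (i == j)) /\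
  (forall i j : 'I_n, (m <= i < m + l)%N -> (j < m + l)%N ->
     M i j = mu *+ (i == j)).
Proof.
case: _ / E M => M; split=> [[B0 [B1 [B2 [B3 ->]]]]|[Mlast Mmid]].
  rewrite castmx_id; split=> i j.
    case: (split_ordP i) => i' -> /=; first by have := ltn_ord i'; lia.
    case: (split_ordP i') => i'' -> /=; first by have := ltn_ord i''; lia.
    move=> _; case: (split_ordP j) => j' ->; rewrite !block_mxE -?val_eqE /=.
      by rewrite mxE (_ : _ == _ = false) //; have := ltn_ord j'; lia.
    case: (split_ordP j') => j'' ->; rewrite !block_mxE !mxE -?val_eqE /=.
      by rewrite (_ : _ == _ = false) //; have := ltn_ord j''; lia.
    by rewrite !eqn_add2l.
  case: (split_ordP i) => i' -> /=; first by have := ltn_ord i'; lia.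
  case: (split_ordP i') => i'' -> /=; last by lia.
  move=> _; case: (split_ordP j) => j' -> /=.
    rewrite !block_mxE mxE -val_eqE /= => _.
    by rewrite (_ : _ == _ = false) //; have := ltn_ord j'; lia.
  case: (split_ordP j') => j'' -> /=; last by lia.
  by rewrite !block_mxE !mxE -[in RHS]val_eqE /= !eqn_add2l.
exists (ulsubmx M), (lsubmx (ursubmx M)), (rsubmx (ursubmx M)).
exists (ursubmx (drsubmx M)); rewrite castmx_id -[LHS]submxK hsubmxK.
have e0 : dlsubmx M = 0.
  apply/matrixP=> i j; rewrite !mxE; case: (split_ordP i) => i' ->.
    rewrite Mmid /=.
    - by rewrite -val_eqE /= (_ : _ == _ = false) //; have := ltn_ord j; lia.
    - by have := ltn_ord i'; lia.
    - by have := ltn_ord j; lia.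
  rewrite Mlast /= ?ord1 ?addn0 // -val_eqE /= (_ : _ == _ = false) //.
  by have := ltn_ord j; lia.
rewrite e0; congr block_mx; rewrite -[LHS]submxK; congr block_mx.
- apply/matrixP=> i j; rewrite !mxE Mmid /= ?leq_addr ?ltn_add2l ?ltn_ord //.
  by rewrite -val_eqE /= !eqn_add2l.
- apply/matrixP=> i j; rewrite !mxE Mlast /= ?ord1 ?addn0 //.
  by rewrite -val_eqE /= (_ : _ == _ = false) //; have := ltn_ord j; lia.
- by apply/matrixP=> i j; rewrite !mxE Mlast /= ?ord1 ?addn0 // eqxx.
Qed.

Lemma three_block_formP n m (M : 'M[F]_n.+1) : (m <= n)%N ->
  three_block_form m M <->
  exists mu, [/\ mu != 0, forall j, M ord_max j = mu^-1 *+ (j == ord_max)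
    & forall i j : 'I_n.+1, (m <= i < n)%N -> (j < n)%N ->
      M i j = mu *+ (i == j)].
Proof.
move=> le_mn; have En : (m + (n.+1 - m - 1))%N = n by lia.
split=> [[E [B0 [B1 [B2 [B3 [mu [mu0 EM]]]]]]]|[mu [mu0 Mlast Mmid]]].
  have [] := (castmx_three_block E M mu).1; first by exists B0, B1, B2, B3.
  rewrite En => Mlast Mmid; exists mu; split=> // j.
  by rewrite Mlast // eq_sym.
have E : (m + ((n.+1 - m - 1) + 1))%N = n.+1 by lia.
have [] := (castmx_three_block E M mu).2.
  rewrite En; split=> // i j Ei.
  by rewrite (_ : i = ord_max) ?Mlast 1?eq_sym //; apply: val_inj.
by move=> B0 [B1 [B2 [B3 EM]]]; exists E, B0, B1, B2, B3, mu.
Qed.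

Lemma det_mx2 (C : 'M[F]_2) : \det C = C 0 0 * C 1 1 - C 0 1 * C 1 0.
Proof.
rewrite (expand_det_row _ 0) !big_ord_recl big_ord0 addr0 /cofactor !det_mx11.
rewrite !mxE /= expr0 expr1 mul1r mulN1r mulrN.
by congr (C _ _ * C _ _ - C _ _ * C _ _); apply: val_inj.
Qed.

(** The size is again a variable, to remove the cast. The indices of the lower right block are given
    by their values, since k and k + 1 are bounded by n only through [E]. *)
Lemma castmx_two_block k n (E : (k + 2)%N = n) (M : 'M[F]_n) :
  (exists (B0 : 'M[F]_k) (B1 : 'M[F]_(k, 2)) (C : 'M[F]_2),
     \det C = 1 /\ M = castmx (E, E) (block_mx B0 B1 0 C)) <->
  (forall i j : 'I_n, (k <= i)%N -> (j < k)%N -> M i j = 0) /\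
  (forall p q : 'I_n, p = k :> nat -> q = k.+1 :> nat ->
     M p p * M q q - M p q * M q p = 1).
Proof.
case: _ / E M => M; split=> [[B0 [B1 [C [detC ->]]]]|[Mdl Mdet]].
  rewrite castmx_id; split=> [i j|p q].
    case: (split_ordP i) => i' -> /=; first by have := ltn_ord i'; lia.
    move=> _; case: (split_ordP j) => j' -> /=; last by lia.
    by rewrite !block_mxE mxE.
  case: (split_ordP p) => p' -> /=; first by have := ltn_ord p'; lia.
  case: (split_ordP q) => q' -> /=; first by have := ltn_ord q'; lia.
  rewrite !block_mxE -detC det_mx2 => Ep Eq.
  have -> : p' = 0 by apply: val_inj => /=; lia.
  by have -> : q' = 1 by apply: val_inj => /=; lia.
exists (ulsubmx M), (ursubmx M), (drsubmx M); rewrite castmx_id; split.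
  by rewrite det_mx2 !mxE Mdet //= ?addn0 ?addn1.
rewrite -[LHS]submxK; congr block_mx; apply/matrixP=> i j.
by rewrite !mxE Mdl //= leq_addr.
Qed.

Lemma two_block_formP n (M : 'M[F]_n.+2) :
  let p := inord n in
  two_block_form M <->
  (forall i j : 'I_n.+2, (n <= i)%N -> (j < n)%N -> M i j = 0) /\
  M p p * M ord_max ord_max - M p ord_max * M ord_max p = 1.
Proof.
move=> p; have En : (n.+2 - 2)%N = n by lia.
have Ep : p = n :> nat by rewrite inordK.
split=> [[E /castmx_two_block]|[Mdl Mdet]].
  by rewrite En => -[Mdl Mdet]; split=> //; apply: Mdet.
have E : ((n.+2 - 2) + 2)%N = n.+2 by lia.
exists E; apply/castmx_two_block; rewrite En; split=> // i j Ei Ej.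
have -> : i = p by apply: val_inj; rewrite /= Ep.
by have -> : j = ord_max by apply: val_inj.
Qed.

End MatrixForms.

(** * The bracket in an adapted basis, in dimension [n.+2] *)

Lemma coord_inj (F : fieldType) (V : vectType F) n (e : n.-tuple V) x y :
  basis_of {:V} e -> (forall i, coord e i x = coord e i y) -> x = y.
Proof.
move=> e_basis eq_xy; rewrite (coord_basis e_basis (memvf x)).
rewrite [RHS](coord_basis e_basis (memvf y)).
by apply: eq_bigr => j _; rewrite eq_xy.
Qed.

Section AdaptedBasis.
Variables (F : fieldType) (L : lieAlgType F) (n m : nat) (e : n.+2.-tuple L).
Hypothesis e_basis : basis_of {:L} e.
Hypothesis e_ideal : lie_ideal <<take n.+1 e>>%VS.
Hypothesis e_abelian : abelian_subspace <<take n.+1 e>>%VS.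
Hypothesis e_center : is_center <<take m e>>%VS.

Let e_free := basis_free e_basis.
Local Notation a := (coord e ord_max).
Let p : 'I_n.+2 := inord n.
Local Notation b := (coord e p).
Local Notation t := e`_n.+1.
Local Notation w := (lie t e`_n).

Let pE : p = n :> nat. Proof. by rewrite inordK. Qed.

Let coordE (i : 'I_n.+2) j : (j < n.+2)%N -> coord e i e`_j = (i == j :> nat)%:R.
Proof. by move=> lt_j; rewrite (coord_free (Ordinal lt_j)) // eq_sym. Qed.

Let at1 : a t = 1. Proof. by rewrite coordE //= eqxx. Qed.

Let bt0 : b t = 0. Proof. by rewrite coordE //= pE ltn_eqF. Qed.

Let as0 : a e`_n = 0. Proof. by rewrite coordE //= gtn_eqF. Qed.

Let bs1 : b e`_n = 1. Proof. by rewrite coordE // pE eqxx. Qed.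

Let ord_maxE (i : 'I_n.+2) : (n < i)%N -> i = ord_max.
Proof. by move=> lt_ni; apply: val_inj => /=; have := ltn_ord i; lia. Qed.

Let ord_geE (i : 'I_n.+2) : (n <= i)%N -> i = p \/ i = ord_max.
Proof.
rewrite leq_eqVlt => /orP[/eqP Ei|/ord_maxE]; last by right.
by left; apply: val_inj; rewrite /= pE.
Qed.

Lemma mem_ideal x : reflect (coord e ord_max x = 0) (x \in <<take n.+1 e>>%VS).
Proof.
apply: (iffP (memv_span_take _ _ e_basis)) => [-> // | ax0 i le_ni].
by rewrite (ord_maxE le_ni).
Qed.

(** Subtracting [a x *: t] moves [x] into the ideal, the kernel of [a], and does not change its
    bracket with [t]. *)
Lemma last_lie x : a (lie t x) = 0.
Proof.
have au0 : a (x - a x *: t) = 0 by rewrite linearB linearZ /= at1 mulr1 subrr.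
have /mem_ideal/(e_ideal t)/mem_ideal := au0.
by rewrite linearB linearZ /= liexx scaler0 subr0.
Qed.

(** The projections of [x] and [y] to the ideal along [t] commute; expanding their bracket gives the
    formula. *)
Lemma lie_rank1_form x y : lie x y = a x *: lie t y - a y *: lie t x.
Proof.
have Uproj z : z - a z *: t \in <<take n.+1 e>>%VS.
  by apply/mem_ideal; rewrite linearB linearZ /= at1 mulr1 subrr.
have := e_abelian (Uproj x) (Uproj y).
rewrite lieBl !lieBr !lieZr !lieZl liexx !scaler0 subr0 [lie x t]lieC scalerN.
by rewrite opprK => /eqP; rewrite subr_eq0 => /eqP <-; rewrite addrK.
Qed.

(** On the kernel of [a], the bracket of [x] with [y] is [- a y *: lie t x], so commuting with [t]
    already means being central. *)
Lemma lie_central x : a x = 0 ->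
  lie t x = 0 <-> forall i : 'I_n.+2, (m <= i)%N -> coord e i x = 0.
Proof.
move=> ax0; split=> [tx0|c0].
  apply/(memv_span_take _ _ e_basis)/e_center => y.
  by rewrite lie_rank1_form ax0 tx0 scale0r scaler0 subr0.
have /(memv_span_take _ _ e_basis)/e_center xZ := c0.
by rewrite lieC xZ oppr0.
Qed.

Lemma lie_basis_abelian (i j : nat) : (i < n.+1)%N -> (j < n.+1)%N ->
  lie e`_i e`_j = 0.
Proof.
move=> lt_i lt_j; apply: e_abelian; apply/mem_ideal.
  by rewrite coordE ?gtn_eqF // ltnW.
by rewrite coordE ?gtn_eqF // ltnW.
Qed.

Lemma lie_last_basis x :
  lie t x = \sum_(i < n.+1) coord e (widen_ord (leq_pred n.+2) i) (lie t x) *: e`_i.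
Proof.
rewrite [LHS](coord_basis e_basis (memvf _)) big_ord_recr /= last_lie.
rewrite scale0r addr0; apply: eq_bigr => i _; congr (coord e _ _ *: _).
exact: val_inj.
Qed.

Lemma lie_center_basis (j : 'I_n.+1) : (j < m)%N -> lie t e`_j = 0.
Proof.
move=> lt_jm; have lt_jn := leqW (ltn_ord j).
apply/lie_central => [|i le_mi]; first by rewrite coordE //= gtn_eqF.
by rewrite coordE // gtn_eqF //; apply: leq_trans le_mi.
Qed.

Hypothesis le_mn : (m <= n)%N.

(** A row vector [v] encodes an element [x] of the ideal, and [v *m A^T] encodes [lie t x]. By
    [lie_central] the kernel of A^T therefore encodes the center, which is the row space of
    [pid_mx m]; rank-nullity concludes. *)
Lemma rank_structure_mx : \rank (structure_mx e) = (n.+1 - m)%N.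
Proof.
suff Erank : \rank (kermx (structure_mx e)^T) = m.
  have := mxrank_ker (structure_mx e)^T; have := rank_leq_row (structure_mx e)^T.
  by rewrite !mxrank_tr Erank /=; lia.
have /eqmx_rank -> : (kermx (structure_mx e)^T == (pid_mx m : 'M[F]_n.+1))%MS.
  apply/rV_eqP => v; pose x := \sum_(j < n.+1) v 0 j *: e`_j.
  have cx (i : 'I_n.+2) : coord e i x = \sum_(j < n.+1) v 0 j * (i == j :> nat)%:R.
    rewrite linear_sum; apply: eq_bigr => j _.
    by rewrite linearZ /= (coordE _ (leqW (ltn_ord j))).
  have cxw (i : 'I_n.+1) : coord e (widen_ord (leq_pred n.+2) i) x = v 0 i.
    rewrite cx (bigD1 i) //= eqxx mulr1 big1 ?addr0 // => j.
    by rewrite -val_eqE eq_sym => /negPf->; rewrite mulr0.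
  have ax0 : a x = 0.
    by rewrite cx big1 // => j _; rewrite /= gtn_eqF ?mulr0.
  have AvE (i : 'I_n.+1) : (v *m (structure_mx e)^T) 0 i =
      coord e (widen_ord (leq_pred n.+2) i) (lie t x).
    rewrite mxE !linear_sum; apply: eq_bigr => j _.
    by rewrite !linearZ /= !mxE.
  have -> : (v <= kermx (structure_mx e)^T)%MS = (lie t x == 0).
    apply/sub_kermxP/eqP => [Av0|tx0].
      by rewrite lie_last_basis big1 // => i _; rewrite -AvE Av0 mxE scale0r.
    by apply/rowP => i; rewrite AvE tx0 linear0 mxE.
  apply/eqP/idP => [/(lie_central ax0) c0|/submxP[u Ev]].
    apply/submxP; exists v; apply/rowP=> i; rewrite mxE (bigD1 i) //= mxE eqxx /=.
    rewrite big1 ?addr0 => [|j /negPf ne_ji]; last by rewrite mxE val_eqE ne_ji mulr0.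
    have [lt_im|le_mi] := ltnP i m; first by rewrite mulr1.
    by rewrite -cxw c0 ?mul0r.
  apply/(lie_central ax0) => i le_mi; rewrite cx big1 // => j _.
  have [Eij|] := eqVneq (i : nat) j; last by rewrite mulr0.
  rewrite Ev mxE big1 ?mul0r // => k _; rewrite mxE.
  have [Ekj|] := eqVneq (k : nat) j; last by rewrite mulr0.
  by rewrite /= Ekj -Eij ltnNge le_mi mulr0.
by rewrite rank_pid_mx // ltnW.
Qed.

(** If m < n, then [lie t] sends [e_m] to x v and [e_n] to y v, so that y e_m - x e_n is central.
    Its coordinate at n is -x, whence x = 0 and [e_m] is central, which is absurd. This excludes the
    line case in [lie_orthogonalP], and it recovers m from the isomorphism type. *)
Lemma lie_line_center v : (forall x, a x = 0 -> lie t x \in <[v]>%VS) -> m = n.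
Proof.
move=> Dv; apply/eqP; rewrite eqn_leq le_mn leqNgt; apply/negP => lt_mn.
have lt_m2 : (m < n.+2)%N by lia.
have am0 : a e`_m = 0 by rewrite coordE //= gtn_eqF // ltnW.
have /vlineP[x Ex] := Dv _ am0; have /vlineP[y Ey] := Dv _ as0.
have au0 : a (y *: e`_m - x *: e`_n) = 0.
  by rewrite linearB !linearZ /= am0 as0 !mulr0 subrr.
have /(lie_central au0)/(_ p) : lie t (y *: e`_m - x *: e`_n) = 0.
  by rewrite lieBr !lieZr Ex Ey !scalerA mulrC subrr.
rewrite pE linearB !linearZ /= bs1 mulr1 coordE // pE gtn_eqF // mulr0 sub0r.
move=> /(_ le_mn)/eqP; rewrite oppr_eq0 => /eqP x0.
have /(lie_central am0)/(_ (Ordinal lt_m2) (leqnn m))/eqP : lie t e`_m = 0.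
  by rewrite Ex x0 scale0r.
by rewrite coordE // eqxx oner_eq0.
Qed.

(** * From orthogonality to the three-block form *)

Let operatorE (J : 'End(L)) (f : {scalar L}) x :
  f (J x) = \sum_j coord e j x * f (J e`_j).
Proof.
rewrite {1}(coord_basis e_basis (memvf x)) !linear_sum.
by apply: eq_bigr => j _; rewrite !linearZ.
Qed.

Lemma lie_orthogonal_three_block (J : 'End(L)) : (m < n)%N ->
  lie_orthogonal J <-> three_block_form m (operator_mx e J).
Proof.
move=> lt_mn; rewrite three_block_formP; last by lia.
(* By [lie_central], D J u = mu D u says that J u - mu u is central, which constrains only the
   coordinates from m on. *)
have DJE mu u : a u = 0 -> a (J u) = 0 ->
    lie t (J u) = mu *: lie t u <->
    forall i : 'I_n.+2, (m <= i)%N -> coord e i (J u) = mu * coord e i u.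
  move=> au0 aJu0; have ad0 : a (J u - mu *: u) = 0.
    by rewrite linearB linearZ /= aJu0 au0 mulr0 subrr.
  have := lie_central ad0; rewrite lieBr lieZr => -[central1 central2].
  split=> [DJ i le_mi|cJ].
    apply/eqP; rewrite -subr_eq0; apply/eqP.
    have /central1/(_ i le_mi) : lie t (J u) - mu *: lie t u = 0.
      by rewrite DJ subrr.
    by rewrite linearB linearZ.
  apply/eqP; rewrite -subr_eq0 central2 // => i le_mi.
  by rewrite linearB linearZ /= cJ // subrr.
apply: (iff_trans (lie_orthogonalP at1 lie_rank1_form J _)).
  by case=> v /lie_line_center Emn; rewrite Emn ltnn in lt_mn.
split=> -[mu [mu0 /= aJ DJ]]; exists mu.
  split=> //.
- by move=> j; rewrite mxE aJ coordE // eq_sym mulr_natr.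
- move=> i j /andP[le_mi _] lt_jn; rewrite mxE.
  have aj0 : a e`_j = 0 by rewrite coordE //= gtn_eqF.
  have := DJ _ aj0; rewrite DJE ?aJ ?aj0 ?mulr0 // => -> //.
  by rewrite coordE // mulr_natr.
have aJ' x : a (J x) = mu^-1 * a x.
  rewrite operatorE (bigD1 ord_max) //= big1 ?addr0.
    by have := aJ ord_max; rewrite mxE eqxx /= mulr1n => ->; rewrite mulrC.
  move=> j /negPf ne_j; have := aJ j; rewrite mxE ne_j mulr0n => ->.
  by rewrite mulr0.
split=> // u au0; have aJu0 : a (J u) = 0 by rewrite aJ' au0 mulr0.
apply/DJE => // i le_mi; have [lt_in|le_ni] := ltnP i n.+1; last first.
  by rewrite (ord_maxE le_ni) aJu0 au0 mulr0.
(* Only the diagonal term survives: the other entries of row i vanish except in the last column,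
   where the arbitrary entry of [B3] is multiplied by [a u], which is zero. *)
rewrite operatorE (bigD1 i) //= big1 => [|j ne_ji].
  have := DJ i i; rewrite mxE eqxx le_mi lt_in => -> //.
  by rewrite addr0 mulrC.
have [lt_jn|le_nj] := ltnP j n.+1.
  have := DJ i j; rewrite mxE le_mi lt_in eq_sym (negPf ne_ji) => -> //.
  by rewrite mulr0.
by rewrite (ord_maxE le_nj) au0 mul0r.
Qed.

(** * The two-block form, for a center of codimension 2 *)

Section Rank1.
Hypothesis Emn : m = n.

Lemma last_lie_neq0 : w != 0.
Proof.
apply/eqP => /(lie_central as0)/(_ p); rewrite Emn pE leqnn bs1.
by move=> /(_ isT)/eqP; rewrite oner_eq0.
Qed.

(** With m = n, the vector z - b(z) e_n - a(z) t has no coordinates outside the center, so D z =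
    b(z) w; substitute this in [lie_rank1_form]. *)
Lemma lie_determinant_form x y : lie x y = (a x * b y - a y * b x) *: w.
Proof.
have tE z : lie t z = b z *: w.
  have az0 : a (z - b z *: e`_n - a z *: t) = 0.
    by rewrite !linearB !linearZ /= as0 at1 mulr0 mulr1 subr0 subrr.
  have /(lie_central az0) : forall i : 'I_n.+2, (m <= i)%N ->
      coord e i (z - b z *: e`_n - a z *: t) = 0.
    move=> i; rewrite Emn leq_eqVlt => /orP[/eqP Ei|lt_ni].
      have -> : i = p by apply: val_inj; rewrite /= pE.
      by rewrite !linearB !linearZ /= bs1 bt0 mulr0 mulr1 subr0 subrr.
    by rewrite (ord_maxE lt_ni) !linearB !linearZ /= as0 at1 mulr0 mulr1 subr0 subrr.
  move/eqP; rewrite !lieBr !lieZr liexx scaler0 subr0 subr_eq0.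
  by move/eqP.
by rewrite [LHS]lie_rank1_form (tE x) (tE y) !scalerA -scalerBl.
Qed.

Lemma lie_orthogonal_two_block (J : 'End(L)) :
  lie_orthogonal J <-> two_block_form (operator_mx e J).
Proof.
rewrite two_block_formP -/p.
apply: (iff_trans (lie_orthogonal_rank1P last_lie_neq0 lie_determinant_form
                     at1 as0 bt0 bs1 J)).
(* The left side orders the basis of the quotient as [t], [e_n], the matrix as [e_n], [t]; reversing
   both rows and columns keeps the determinant. *)
have detE : a (J t) * b (J e`_n) - a (J e`_n) * b (J t) =
  operator_mx e J p p * operator_mx e J ord_max ord_max
  - operator_mx e J p ord_max * operator_mx e J ord_max p.
  by rewrite !mxE pE /=; ring.
rewrite detE; split=> -[J0 ->]; split=> //.
  move=> i j le_ni lt_jn; rewrite mxE.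
  have [||a0 b0] := J0 e`_j.
  - by rewrite /= coordE //= gtn_eqF // ltnW.
  - by rewrite /= coordE //= pE gtn_eqF.
  by have [->|->] := ord_geE le_ni.
move=> x ax0 bx0.
suff cJ0 (i : 'I_n.+2) : (n <= i)%N -> coord e i (J x) = 0.
  by split; apply: cJ0 => //; rewrite pE.
move=> le_ni; rewrite operatorE /= big1 // => j _.
have [lt_jn|le_nj] := ltnP j n.
  by have := J0 i j le_ni lt_jn; rewrite mxE => ->; rewrite mulr0.
by have [->|->] := ord_geE le_nj; rewrite ?ax0 ?bx0 mul0r.
Qed.
End Rank1.

End AdaptedBasis.

(** * Isomorphisms and the two model algebras *)

Lemma dim_ffun_rV (F : fieldType) k l :
  \dim {:({ffun 'I_k -> g1 F} * 'rV[F]_l)%type} = (k + l)%N.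
Proof.
rewrite dimvf; transitivity (#|'I_k| * 1 + 1 * l)%N => //.
by rewrite card_ord muln1 mul1n.
Qed.

Lemma lie_isomorphic_of_injective (F : fieldType) (L1 L2 : lieAlgType F)
    (f : L1 -> L2) :
  linear f -> (forall x, f x = 0 -> x = 0) -> \dim {:L1} = \dim {:L2} ->
  (forall x y, f (lie x y) = lie (f x) (f y)) -> lie_isomorphic L1 L2.
Proof.
move=> f_lin f_inj dim12 f_lie.
pose fL : {linear L1 -> L2} := HB.pack f (GRing.isLinear.Build F L1 L2 _ f f_lin).
exists (linfun fL); split=> [|x y]; last by rewrite !lfunE /= f_lie.
apply: lker0_bijective dim12; rewrite -subv0; apply/subvP => x.
by rewrite memv_ker lfunE memv0 => /eqP/f_inj->.
Qed.

(** Having all brackets in one line is an isomorphism invariant; it is pulled back from the two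
    models to [L]. *)
Lemma lie_isomorphic_line (F : fieldType) (L1 L2 : lieAlgType F) (v2 : L2) :
  lie_isomorphic L1 L2 -> (forall x y : L2, lie x y \in <[v2]>%VS) ->
  exists v1, forall x y : L1, lie x y \in <[v1]>%VS.
Proof.
move=> [f [[g fK gK] f_lie]] line2; exists (g v2) => x y.
have /vlineP[k Ek] := line2 (f x) (f y); apply/vlineP; exists k.
by apply: (can_inj fK); rewrite f_lie Ek linearZ /= gK.
Qed.

Lemma lie_line_g2 (F : fieldType) k (x y : ({ffun 'I_k -> g1 F} * g2 F)%type) :
  lie x y \in <[(0, delta_mx 0 0)%R : ({ffun 'I_k -> g1 F} * g2 F)%type]>%VS.
Proof.
apply/vlineP; exists (x.2 0 0 * y.2 0 1 - x.2 0 1 * y.2 0 0).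
apply: injective_projections => //=.
by apply/ffunP => i; rewrite !ffunE scaler0.
Qed.

Lemma lie_line_heisenberg (F : fieldType) k
    (x y : ({ffun 'I_k -> g1 F} * heisenberg F)%type) :
  lie x y \in
    <[(0, delta_mx 0 0)%R : ({ffun 'I_k -> g1 F} * heisenberg F)%type]>%VS.
Proof.
apply/vlineP; exists (x.2 0 1 * y.2 0 2 - x.2 0 2 * y.2 0 1).
apply: injective_projections => //=.
by apply/ffunP => i; rewrite !ffunE scaler0.
Qed.

(** * Classification of the algebras with center of codimension 2 *)

Section Classification.
Variables (F : fieldType) (L : lieAlgType F) (n : nat) (e : n.+2.-tuple L).
Hypothesis e_basis : basis_of {:L} e.
Local Notation a := (coord e ord_max).
Local Notation b := (coord e (inord n)).
Variable w : L.
Hypothesis lieE : forall x y, lie x y = (a x * b y - a y * b x) *: w.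
Hypothesis aw0 : a w = 0.

Let le_n2 := leqW (leqnSn n).
Local Notation c i := (coord e (widen_ord le_n2 i)).

Let dimL : \dim {:L} = n.+2.
Proof. by rewrite -(size_basis e_basis). Qed.

Let eq0_coord x :
  a x = 0 -> b x = 0 -> (forall i : 'I_n, c i x = 0) -> x = 0.
Proof.
move=> ax0 bx0 cx0; apply: (coord_inj e_basis) => i; rewrite linear0.
have [lt_in|le_ni] := ltnP i n.
  by rewrite -(cx0 (Ordinal lt_in)); congr (coord e _ x); apply: val_inj.
have [Ei|ne_in] := eqVneq (i : nat) n.
  by rewrite -bx0; congr (coord e _ x); apply: val_inj; rewrite /= inordK.
rewrite -ax0; congr (coord e _ x); apply: val_inj => /=.
by have := ltn_ord i; lia.
Qed.

(* The first coordinates of the map are a projection of [L] along [w], which spans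
   the derived algebra. *)
Lemma lie_isomorphic_g2 : b w != 0 ->
  lie_isomorphic L ({ffun 'I_n -> g1 F} * g2 F)%type.
Proof.
move=> bw0.
(* In the second component [w] goes to u_0. The factor [- b w] matches
   [lie w y = - (a y * b w) *: w] with the relation [u_0, u_1] = u_0 of [g2]. *)
pose f x : ({ffun 'I_n -> g1 F} * g2 F)%type :=
  ([ffun i : 'I_n => (c i x - c i w / b w * b x) : g1 F],
   \row_j [:: b x / b w; - b w * a x]`_j).
apply: (@lie_isomorphic_of_injective _ _ _ f).
- move=> k x y; apply: injective_projections => /=.
    by apply/ffunP => i; rewrite !ffunE !linearP /= /GRing.scale /=; ring.
  apply/rowP => j; rewrite !mxE.
  by case: j => [[|[|//]] ? /=]; rewrite !linearP /=; ring.
- move=> x [/ffunP f1 /rowP f2].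
  have := f2 0; have := f2 1; rewrite !mxE /= => /eqP.
  rewrite mulf_eq0 oppr_eq0 (negPf bw0) /= => /eqP ax0 /eqP.
  rewrite mulf_eq0 invr_eq0 (negPf bw0) orbF => /eqP bx0.
  apply: eq0_coord => // i; have := f1 i.
  by rewrite !ffunE bx0 mulr0 subr0.
- by rewrite dimL dim_ffun_rV addn2.
move=> x y; apply: injective_projections => /=.
  apply/ffunP => i; rewrite !ffunE lieE !linearZ /=.
  (* The Abelian summand has zero bracket, and the projected coordinates vanish on [w]. *)
  by transitivity (0 : F) => //; field.
transitivity (one_relation 0 0 1 (f x).2 (f y).2) => //.
apply/rowP => j; rewrite /one_relation !mxE lieE !linearZ /= aw0.
by case: j => [[|[|//]] ? /=]; field.
Qed.

(* Dropping the [l]-th coordinate after projecting along [w] gives the Abelian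
   summand; the [l]-th coordinate itself is the one of the vector e of the Heisenberg
   algebra. *)
Lemma lie_isomorphic_heisenberg k (En : n = k.+1) (l : 'I_n) :
  b w = 0 -> c l w != 0 ->
  lie_isomorphic L ({ffun 'I_k -> g1 F} * heisenberg F)%type.
Proof.
move=> bw0 cw0.
have Ek : k = n.-1 by rewrite En.
pose h (i : 'I_k) : 'I_n := lift l (cast_ord Ek i).
(* In the second component [w] goes to u_0, while [a] and [b] serve as the coordinates of p and q:
   the coefficient in [lieE] is then exactly the Heisenberg bracket. *)
pose f x : ({ffun 'I_k -> g1 F} * heisenberg F)%type :=
  ([ffun i : 'I_k => (c (h i) x - c (h i) w / c l w * c l x) : g1 F],
   \row_j [:: c l x / c l w; a x; b x]`_j).
apply: (@lie_isomorphic_of_injective _ _ _ f).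
- move=> r x y; apply: injective_projections => /=.
    by apply/ffunP => i; rewrite !ffunE !linearP /= /GRing.scale /=; ring.
  apply/rowP => j; rewrite !mxE.
  by case: j => [[|[|[|//]]] ? /=]; rewrite !linearP /=; ring.
- move=> x [/ffunP f1 /rowP f2].
  have := f2 0; have := f2 1; have := f2 2; rewrite !mxE /= => bx0 ax0 /eqP.
  rewrite mulf_eq0 invr_eq0 (negPf cw0) orbF => /eqP cx0.
  apply: eq0_coord => // i; case: (unliftP l i) => [i' ->|-> //].
  have := f1 (cast_ord (esym Ek) i').
  by rewrite !ffunE cx0 mulr0 subr0 /h cast_ordKV.
- by rewrite dimL dim_ffun_rV En addn3.
move=> x y; apply: injective_projections => /=.
  apply/ffunP => i; rewrite !ffunE lieE !linearZ /=.
  by transitivity (0 : F) => //; field.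
transitivity (one_relation 0 1 2 (f x).2 (f y).2) => //.
apply/rowP => j; rewrite /one_relation !mxE lieE !linearZ /= aw0 bw0.
by case: j => [[|[|[|//]]] ? /=]; field.
Qed.

(** The cases are separated by whether [w], which spans the derived algebra, is central, that is,
    whether [b w = 0]. If it is, the nonzero [w] has a nonzero coordinate among the first n, which
    forces [0 < n]. *)
Lemma lie_isomorphic_g2_or_heisenberg : w != 0 ->
  lie_isomorphic L ({ffun 'I_n -> g1 F} * g2 F)%type \/
  (0 < n)%N /\ lie_isomorphic L ({ffun 'I_n.-1 -> g1 F} * heisenberg F)%type.
Proof.
move=> w0; have [bw0|bw0] := eqVneq (b w) 0; last by left; apply: lie_isomorphic_g2.
have [l cw0] : exists l, c l w != 0.
  apply/existsP; rewrite -negb_forall; apply: contra w0 => /forallP cw0.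
  by apply/eqP/eq0_coord => // l; apply/eqP.
have n_gt0 : (0 < n)%N by apply: leq_ltn_trans (ltn_ord l).
right; split=> //; apply: (lie_isomorphic_heisenberg _ bw0 cw0).
by rewrite prednK.
Qed.

End Classification.

(** * Assembly of the structure, orthogonality and classification results *)

Theorem proposition10 (F : fieldType) (L : lieAlgType F) (n m : nat)
    (e : n.-tuple L) (Z : {vspace L})
    (charF0 : [pchar F] =i pred0)
    (dimL : \dim {:L} = n)
    (L_almost_abelian : almost_abelian L)
    (L_not_abelian : ~ abelian_lie L)
    (e_basis : basis_of {:L} e)
    (e_ideal : lie_ideal <<take n.-1 e>>%VS)
    (e_abelian : abelian_subspace <<take n.-1 e>>%VS)
    (Z_center : is_center Z)
    (e_center : <<take m e>>%VS = Z)
    (dimZ : m = \dim Z)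
    (lt_m : (m < n.-1)%N) :
  let A := structure_mx e in
  [/\ (forall i j : 'I_n.-1, lie e`_i e`_j = 0),
      (forall j : 'I_n.-1, lie e`_n.-1 e`_j = \sum_(i < n.-1) A i j *: e`_i),
      (forall i j : 'I_n.-1, (j < m)%N -> A i j = 0)
    & \rank A = (n.-1 - m)%N] /\
  ((m < n - 2)%N ->
    forall J : 'End(L),
      lie_orthogonal J <-> three_block_form m (operator_mx e J)) /\
  (m = (n - 2)%N <->
    lie_isomorphic L ({ffun 'I_(n - 2) -> g1 F} * g2 F)%type \/
    (3 <= n)%N /\
    lie_isomorphic L ({ffun 'I_(n - 3) -> g1 F} * heisenberg F)%type) /\
  (m = (n - 2)%N ->
    forall J : 'End(L),
      lie_orthogonal J <-> two_block_form (operator_mx e J)).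
Proof.
(* The inequality [m < n.-1] excludes sizes 0 and 1; from here on the dimension is [n.+2], and the
   borderline value of m is n. *)
case: n => [|[|n]] in e dimL e_basis e_ideal e_abelian e_center lt_m *; try by [].
move=> A; rewrite /= in lt_m e_ideal e_abelian.
have le_mn : (m <= n)%N by [].
have centerE : is_center <<take m e>>%VS by rewrite e_center.
have En : (n.+2 - 2)%N = n by rewrite subn2.
have En3 : (n.+2 - 3)%N = n.-1 by lia.
split; [split | split; [|split]].
- by move=> i j; apply: lie_basis_abelian.
- move=> j; rewrite (lie_last_basis e_basis e_ideal).
  by apply: eq_bigr => i _; rewrite mxE.
- move=> i j lt_jm; rewrite mxE /=.
  by rewrite (lie_center_basis e_basis e_abelian centerE) ?linear0.
- exact: rank_structure_mx.
- by rewrite En => lt_mn J; apply: lie_orthogonal_three_block.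
- rewrite En En3; split=> [Emn|].
    have lieE := lie_determinant_form e_basis e_abelian centerE Emn.
    apply: lie_isomorphic_g2_or_heisenberg lieE _ _.
    + exact: e_basis.
    + exact: last_lie.
    + exact: last_lie_neq0.
  (* In both models all brackets lie in one line, hence also in [L], and [lie_line_center] then
     gives m = n. *)
  move=> iso; have [v lineL] : exists v, forall x y : L, lie x y \in <[v]>%VS.
    case: iso => [iso|[_ iso]]; apply: (lie_isomorphic_line iso) => x y.
      exact: lie_line_g2.
    exact: lie_line_heisenberg.
  by apply: (lie_line_center e_basis e_abelian centerE le_mn (v := v)) => x _.
- by rewrite En => Emn J; apply: lie_orthogonal_two_block.
Qed.
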